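(* Let $N,d,C\in\mathbb{N}$, let $r\ge 1$ and $0<\delta\le 1$, and let $(\mathbf{x}_1,y_1),\dots,(\mathbf{x}_N,y_N)\in\mathbb{R}^d\times\{1,\dots,C\}$ be a set of $N$ labeled samples with $\|\mathbf{x}_i\|\le r$ for every $i$ and $\|\mathbf{x}_i-\mathbf{x}_j\|\ge\delta$ for every $i\ne j$. Denote $R:=dNCr\delta^{-1}$. Let $L\in\mathbb{N}$ with $1\le L\le\sqrt{N}$. Then there exists a ReLU neural network $F:\mathbb{R}^d\to\mathbb{R}$ with width $O\left(\frac{N}{L^2}\right)$, depth $O\left(\frac{L}{\sqrt{\log(L)}}\cdot\log(R)\right)$, and a total of $O\left(\frac{N}{L\sqrt{\log(L)}}\cdot\log(R)+d\right)$ parameters, such that $F(\mathbf{x}_i)=y_i$ for every $i\in\{1,\dots,N\}$.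
   Context: $\|\cdot\|$ is the Euclidean norm, $\log$ is the base-2 logarithm, and $O(\cdot)$ hides constant factors. $\sigma(z)=\max\{0,z\}$ is the ReLU function, applied coordinatewise to vectors. A ReLU neural network of depth $\ell$ is a function $\mathcal{N}:\mathbb{R}^d\to\mathbb{R}$ computed by $\mathbf{h}^{(1)}=\sigma(W^{(1)}\mathbf{x}+\mathbf{b}^{(1)})$ with $W^{(1)}\in\mathbb{R}^{m_1\times d}$, $\mathbf{b}^{(1)}\in\mathbb{R}^{m_1}$; $\mathbf{h}^{(i)}=\sigma(W^{(i)}\mathbf{h}^{(i-1)}+\mathbf{b}^{(i)})$ with $W^{(i)}\in\mathbb{R}^{m_i\times m_{i-1}}$, $\mathbf{b}^{(i)}\in\mathbb{R}^{m_i}$ for $i=2,\dots,\ell-1$; and $\mathcal{N}(\mathbf{x})=W^{(\ell)}\mathbf{h}^{(\ell-1)}+\mathbf{b}^{(\ell)}$ with $W^{(\ell)}\in\mathbb{R}^{1\times m_{\ell-1}}$, $\mathbf{b}^{(\ell)}\in\mathbb{R}$. Its width is $\max\{m_1,\dots,m_{\ell-1}\}$. The number of parameters of the network is the number of its weights which are non-zero.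
   Formalization: At L = 1 the stated bounds divide by sqrt(log 1) = 0 and are undefined, so log(L) and log(R) in the bounds are read as max{1, log(·)}; for L ≥ 2 this changes nothing. N, d and C are taken to be positive. *)

(* Defs.v *)
From HB Require Import structures.
From mathcomp Require Import all_boot all_order all_algebra.
From mathcomp Require Import reals exp.

Set Implicit Arguments.
Unset Strict Implicit.
Unset Printing Implicit Defensive.

Import Order.TTheory GRing.Theory Num.Theory.
Local Open Scope ring_scope.

(* The norm `|x| of a matrix in MathComp-Analysis is the max norm. *)
Definition l2norm (R : realType) (d : nat) (x : 'cV[R]_d) : R :=
  Num.sqrt (\sum_(k < d) x k 0 ^+ 2).

Definition log2 (R : realType) (z : R) : R := ln z / ln 2.

(* Base-2 logarithm cut off at 1 from below. In a bound such as
   O(L / sqrt (log L) * log Q), the plain logarithm vanishes at 1, where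
   MathComp's x / 0 = 0 would turn the bound into 0. The cutoff changes nothing
   for arguments >= 2: see log2cE. *)
Definition log2c (R : realType) (z : R) : R := Num.max 1 (log2 z).

Lemma log2cE (R : realType) (z : R) : 2 <= z -> log2c z = log2 z.
Proof.
move=> z2; apply/max_idPr; rewrite /log2.
have z0 : 0 < z by rewrite (lt_le_trans _ z2).
by rewrite ler_pdivlMr ?ln_gt0 ?ltr1n// mul1r ler_ln ?posrE.
Qed.

Definition relu (R : realType) (m : nat) (v : 'cV[R]_m) : 'cV[R]_m :=
  map_mx (fun z => Num.max 0 z) v.

(* ReLU networks with n inputs and one output, presented from the input side:
   AddLayer prepends a hidden layer x |-> relu (W x + b) to a network, and
   TwoLayer is a hidden layer followed by the affine output layer
   h |-> V h + c. Hence the depth is always at least 2; the hidden layers are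
   required to be nonempty. *)
Inductive relu_net (R : realType) : nat -> Type :=
| TwoLayer n m of (0 < m)%N & 'M[R]_(m, n) & 'cV[R]_m & 'rV[R]_m & R :
    relu_net R n
| AddLayer n m of (0 < m)%N & 'M[R]_(m, n) & 'cV[R]_m & relu_net R m :
    relu_net R n.

Fixpoint net_fun (R : realType) (n : nat) (F : relu_net R n) : 'cV[R]_n -> R :=
  match F in relu_net _ n0 return 'cV[R]_n0 -> R with
  | TwoLayer _ _ _ W b V c => fun x => (V *m relu (W *m x + b)) 0 0 + c
  | AddLayer _ _ _ W b G => fun x => net_fun G (relu (W *m x + b))
  end.

(* The output layer counts towards the depth. *)
Fixpoint net_depth (R : realType) (n : nat) (F : relu_net R n) : nat :=
  match F with
  | TwoLayer _ _ _ _ _ _ _ => 2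
  | AddLayer _ _ _ _ _ G => (net_depth G).+1
  end.

Fixpoint net_width (R : realType) (n : nat) (F : relu_net R n) : nat :=
  match F with
  | TwoLayer _ m _ _ _ _ _ => m
  | AddLayer _ m _ _ _ G => maxn m (net_width G)
  end.

Definition nnz (R : realType) (m n : nat) (A : 'M[R]_(m, n)) : nat :=
  (\sum_(i < m) \sum_(j < n) (A i j != 0%R))%N.

(* Nonzero bias terms are counted as well as nonzero matrix entries. *)
Fixpoint net_params (R : realType) (n : nat) (F : relu_net R n) : nat :=
  match F with
  | TwoLayer _ _ _ W b V c => (nnz W + nnz b + nnz V + (c != 0%R))%N
  | AddLayer _ _ _ W b G => (nnz W + nnz b + net_params G)%N
  end.

(* Main.v *)
(* A generic integer direction projects the samples to reals that are pairwise
   at distance at least 2 and polynomially bounded in Q. The sorted projections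
   are split into O(N / L^2) blocks, each handled by a subnetwork of constant
   width running in parallel with the others; a subnetwork outputs 0 outside its
   block, so that the outputs can be summed. Within a block there are about
   L sqrt(log L) intervals of about L / sqrt(log L) samples: threshold tests load
   into a register an integer encoding the samples and labels of the interval of
   the input, then its bits are extracted one by one, each decoded sample is
   compared with the input, and the label of the matching one is added to the
   output. Each elementary operation has the form "if an affine test passes, add
   a constant vector to the registers" and takes two layers. *)
Require Import Defs.
From mathcomp Require Import all_boot all_order all_algebra.
From mathcomp Require Import boolp reals exp.
From mathcomp Require Import zify ring lra.

Set Implicit Arguments.
Unset Strict Implicit.
Unset Printing Implicit Defensive.

Import Order.TTheory GRing.Theory Num.Theory.
Local Open Scope ring_scope.

(** * Networks with a constant set of neurons *)

Section Layers.
Variable R : realType.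

(** Indexing neurons by a structured [finType] lets registers, test neurons and parallel copies be
    told apart by pattern matching. *)
Definition layer (I : finType) : Type := (I -> I -> R) * (I -> R).

Definition layer_fun (I : finType) (l : layer I) (s : I -> R) (i : I) : R :=
  Num.max 0 (\sum_j l.1 i j * s j + l.2 i).

Definition col_of (I : finType) (s : I -> R) : 'cV[R]_#|I| :=
  \col_i s (enum_val i).

Definition layer_mx (I : finType) (l : layer I) : 'M[R]_#|I| :=
  \matrix_(i, j) l.1 (enum_val i) (enum_val j).

Lemma relu_layer (I : finType) (l : layer I) (s : I -> R) :
  relu (layer_mx l *m col_of s + col_of l.2) = col_of (layer_fun l s).
Proof.
apply/colP => i; rewrite !mxE /layer_fun; congr (Num.max _ (_ + _)).
rewrite [RHS](reindex _ (onW_bij _ (enum_val_bij I))) /=.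
by apply: eq_bigr => j _; rewrite !mxE.
Qed.

(** The recursion ends in an identity hidden layer, whose ReLU is the [Num.max 0] of
    [net_of_layers_fun]. *)
Fixpoint net_of_layers (I : finType) (I0 : (0 < #|I|)%N) (ls : seq (layer I))
    (V : I -> R) : relu_net R #|I| :=
  if ls is l :: ls' then
    AddLayer I0 (layer_mx l) (col_of l.2) (net_of_layers I0 ls' V)
  else TwoLayer I0 1%:M 0 (col_of V)^T 0.

Definition layers_fun (I : finType) (ls : seq (layer I)) (s : I -> R) :=
  foldl (fun s l => layer_fun l s) s ls.

Lemma net_of_layers_fun (I : finType) (I0 : (0 < #|I|)%N) ls V s :
  net_fun (net_of_layers I0 ls V) (col_of s) =
  \sum_i V i * Num.max 0 (layers_fun ls s i).
Proof.
elim: ls s => [|l ls IH] s /=; last by rewrite relu_layer IH.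
rewrite mul1mx !addr0 !mxE [RHS](reindex _ (onW_bij _ (enum_val_bij I))) /=.
by apply: eq_bigr => j _; rewrite !mxE.
Qed.

Lemma net_of_layers_depth (I : finType) (I0 : (0 < #|I|)%N) ls V :
  net_depth (net_of_layers I0 ls V) = (size ls).+2.
Proof. by elim: ls => //= l ls ->. Qed.

Lemma net_of_layers_width (I : finType) (I0 : (0 < #|I|)%N) ls V :
  net_width (net_of_layers I0 ls V) = #|I|.
Proof. by elim: ls => //= l ls ->; rewrite maxnn. Qed.

Definition weights (I : finType) (l : layer I) : nat :=
  (\sum_i \sum_j (l.1 i j != 0%R))%N.

Lemma nnz_layer (I : finType) (l : layer I) : nnz (layer_mx l) = weights l.
Proof.
rewrite /nnz /weights [RHS](reindex _ (onW_bij _ (enum_val_bij I))) /=.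
apply: eq_bigr => i _; rewrite [RHS](reindex _ (onW_bij _ (enum_val_bij I))) /=.
by apply: eq_bigr => j _; rewrite mxE.
Qed.

Lemma nnz_le m n (A : 'M[R]_(m, n)) : (nnz A <= m * n)%N.
Proof.
rewrite /nnz -[m in leqRHS]card_ord -sum_nat_const; apply: leq_sum => i _.
apply: leq_trans (leq_sum _ (fun j _ => leq_b1 _)) _.
by rewrite sum_nat_const card_ord muln1.
Qed.

Lemma nnz_id n : nnz (1%:M : 'M[R]_n) = n.
Proof.
rewrite /nnz -[RHS]card_ord -sum1_card; apply: eq_bigr => i _.
rewrite (bigD1 i)//= mxE eqxx oner_eq0 big1// => j ji.
by rewrite mxE [i == j]eq_sym (negbTE ji) eqxx.
Qed.

Lemma net_of_layers_params (I : finType) (I0 : (0 < #|I|)%N) ls V w :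
  (forall l, List.In l ls -> (weights l <= w)%N) ->
  (net_params (net_of_layers I0 ls V) <= size ls * (w + #|I|) + 3 * #|I|)%N.
Proof.
elim: ls => [_|l ls IH lw] /=.
  rewrite nnz_id eqxx addn0 mul0n add0n !mulSn mul0n addn0 addnA.
  apply: leq_add (leq_add (leqnn _) _) _.
    by rewrite -[leqRHS]muln1 nnz_le.
  by rewrite -[leqRHS]mul1n nnz_le.
rewrite mulSn -[leqRHS]addnA; apply: leq_add (leq_add _ _) (IH _) => [||l' h].
- by rewrite nnz_layer; apply: lw; left.
- by rewrite -[leqRHS]muln1 nnz_le.
- by apply: lw; right.
Qed.

(** Block-diagonal layer: the copies do not interact, so the number of nonzero weights is only
    linear in [G]. *)
Definition par (I : finType) (G : nat) (l : 'I_G -> layer I) : layer ('I_G * I)%type :=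
  (fun p q => if p.1 == q.1 then (l p.1).1 p.2 q.2 else 0,
   fun p => (l p.1).2 p.2).

Lemma par_fun (I : finType) (G : nat) (l : 'I_G -> layer I) s p :
  layer_fun (par l) s p = layer_fun (l p.1) (fun a => s (p.1, a)) p.2.
Proof.
case: p => g a; rewrite /layer_fun /=; congr (Num.max _ (_ + _)).
transitivity (\sum_h \sum_b (if g == h then (l g).1 a b else 0) * s (h, b)).
  by rewrite pair_bigA; apply: eq_bigr => -[].
rewrite (bigD1 g)//= eqxx [X in _ + X]big1 ?addr0// => h hg.
by rewrite eq_sym (negbTE hg) big1// => b _; rewrite mul0r.
Qed.

Lemma par_weights (I : finType) (G : nat) (l : 'I_G -> layer I) :
  (weights (par l) <= G * #|I| ^ 2)%N.
Proof.
rewrite /weights.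
rewrite (eq_bigr (fun p => \sum_q ((par l).1 (p.1, p.2) q != 0%R))%N) => [|[]//].
rewrite -(pair_bigA _ (fun g a => \sum_q ((par l).1 (g, a) q != 0%R))%N).
rewrite -[G in leqRHS]card_ord -sum_nat_const; apply: leq_sum => g _.
rewrite -mulnn -sum_nat_const; apply: leq_sum => a _.
rewrite -(pair_bigA _ (fun h b => ((if g == h then (l g).1 a b else 0) != 0%R) : nat)).
rewrite (bigD1 g)//= [X in (_ + X)%N]big1 ?addn0 => [|h hg]; last first.
  by rewrite eq_sym (negbTE hg) big1// => b _; rewrite eqxx.
by apply: leq_trans (leq_sum _ (fun j _ => leq_b1 _)) _; rewrite sum_nat_const muln1.
Qed.

End Layers.

(** * Conditional updates and their simulation by pairs of layers *)

Section Instructions.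
Variables (R : realType) (n : nat).

(* "If coef . s >= thr then s := s + upd", for a state s of n registers. *)
Record instr := Instr { coef : 'I_n -> R; thr : R; upd : 'I_n -> R }.

Implicit Types (i : instr) (s : 'I_n -> R).

Definition lhs i s : R := \sum_r coef i r * s r.

Definition step i s (r : 'I_n) : R := s r + (if thr i <= lhs i s then upd i r else 0).

(** Nonnegative registers pass the ReLU unchanged; [inr false] and [inr true] hold the ramps with
    offsets [1 - thr] and [- thr], whose difference [update_layer] multiplies by [upd]. *)
Definition test_layer i : layer R ('I_n + bool)%type :=
  (fun (a b : 'I_n + bool) => match a, b with
              | inl r, inl r' => (r == r')%:R
              | inr _, inl r' => coef i r'
              | _, inr _ => 0
              end,
   fun a => if a is inr c then (~~ c)%:R - thr i else 0).

Definition update_layer i : layer R ('I_n + bool)%type :=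
  (fun a (b : 'I_n + bool) => match a, b with
              | inl r, inl r' => (r == r')%:R
              | inl r, inr c => (-1) ^+ c * upd i r
              | inr _, _ => 0
              end,
   fun _ => 0).

Definition enc s (a : 'I_n + bool) : R := if a is inl r then s r else 0.

Lemma sum_delta s (r : 'I_n) : \sum_(r' < n) (r == r')%:R * s r' = s r.
Proof.
rewrite (bigD1 r)//= eqxx mul1r big1 ?addr0// => r' rr.
by rewrite eq_sym (negbTE rr) mul0r.
Qed.

(* On states whose test value avoids the open interval (thr - 1, thr), the
   two-neuron ramp max(0, v - thr + 1) - max(0, v - thr) is an exact step. *)
Lemma step_layers i s : (forall r, 0 <= s r) -> (forall r, 0 <= step i s r) ->
  (thr i <= lhs i s \/ lhs i s <= thr i - 1) ->
  layer_fun (update_layer i) (layer_fun (test_layer i) (enc s)) = enc (step i s).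
Proof.
move=> s0 s1 gap.
have E1 r : layer_fun (test_layer i) (enc s) (inl r) = s r.
  rewrite /layer_fun big_sumType /= sum_delta big1; last by move=> c _; rewrite mul0r.
  by rewrite !addr0; apply/max_idPr.
have E2 c : layer_fun (test_layer i) (enc s) (inr c) =
    Num.max 0 (lhs i s + ((~~ c)%:R - thr i)).
  rewrite /layer_fun big_sumType /= [X in _ + X + _]big1 ?addr0// => c' _.
  by rewrite mul0r.
move: (layer_fun (test_layer i) (enc s)) E1 E2 => t E1 E2.
apply: funext => -[r|c]; rewrite /layer_fun /=; last first.
  by rewrite addr0 big1 ?maxxx// => j _; rewrite mul0r.
rewrite big_sumType big_bool /= !E2 /= addr0 -[RHS](max_idPr (s1 r)) /step.
have -> : \sum_(r' < n) (r == r')%:R * t (inl r') = s r.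
  by rewrite -[RHS]sum_delta; apply: eq_bigr => r' _; rewrite E1.
congr (Num.max _ (_ + _)); rewrite expr1 expr0 mul1r mulN1r.
case: gap => h.
  rewrite h !(max_idPr _); [by ring|lra|lra].
rewrite leNgt (le_lt_trans h) /=; last lra.
by rewrite !(max_idPl _) ?mulr0 ?addr0//; lra.
Qed.

(** A run carries along the conditions that make [step_layers] exact at each instruction. *)
Fixpoint exec (p : seq instr) s s' : Prop :=
  if p is i :: p' then
    [/\ forall r, 0 <= s r, forall r, 0 <= step i s r,
        thr i <= lhs i s \/ lhs i s <= thr i - 1 & exec p' (step i s) s']
  else s = s'.

Lemma exec_cat p q s1 s2 s3 :
  exec p s1 s2 -> exec q s2 s3 -> exec (p ++ q) s1 s3.
Proof.
elim: p s1 => [s1 /= ->//|i p IH s1 /= [? ? ? ?] ?]; split=> //; exact: IH.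
Qed.

(** An instruction of [p] is a family over the copies: the programs have a common length, but each
    copy has its own constants. *)
Definition prog_layers (G : nat) (p : seq ('I_G -> instr)) :
    seq (layer R ('I_G * ('I_n + bool))%type) :=
  flatten [seq [:: par (fun g => test_layer (c g)); par (fun g => update_layer (c g))]
          | c <- p].

Lemma size_prog_layers (G : nat) (p : seq ('I_G -> instr)) :
  size (prog_layers p) = (2 * size p)%N.
Proof. by elim: p => //= i p; rewrite /prog_layers /= => ->; lia. Qed.

Lemma prog_layers_weights (G : nat) (p : seq ('I_G -> instr)) l :
  List.In l (prog_layers p) -> (weights l <= G * (n + 2) ^ 2)%N.
Proof.
have E : (n + 2 = #|{: 'I_n + bool}|)%N by rewrite card_sum card_ord card_bool.
elim: p => //= i p IH [|[|//]] <-; rewrite E; exact: par_weights.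
Qed.

Lemma exec_prog_layers (G : nat) (p : seq ('I_G -> instr)) (s s' : 'I_G -> 'I_n -> R) :
  (forall g, exec [seq c g | c <- p] (s g) (s' g)) ->
  layers_fun (prog_layers p) (fun q => enc (s q.1) q.2) = fun q => enc (s' q.1) q.2.
Proof.
elim: p s => [s e|i p IH s e].
  by apply: funext => -[g a] /=; rewrite (e g).
rewrite /layers_fun /=.
rewrite [X in foldl _ X](_ : _ = fun q => enc (step (i q.1) (s q.1)) q.2).
  by apply: (IH (fun g => step (i g) (s g))) => g; have [] := e g.
apply: funext => -[g a]; have [h1 h2 h3 _] := e g.
rewrite par_fun /= -(step_layers h1 h2 h3).
by congr (layer_fun _ _ _); apply: funext => b; rewrite par_fun.
Qed.

End Instructions.

(** * Bit extraction *)

Section Programs.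
Variable R : realType.

(* The registers are, in order: the sample z, the code U still to be decoded,
   the decoded sample value P, the flag g "z matches P", and the output o. *)
Definition state (z : R) (U P g o : nat) : 'I_5 -> R :=
  fun r => nth 0 [:: z; U%:R; P%:R; g%:R; o%:R] r.

Definition rule (c : seq R) (t : R) (d : seq R) : instr R 5 :=
  Instr (fun r => nth 0 c r) t (fun r => nth 0 d r).

Lemma lhs_rule c t d z U P g o :
  lhs (rule c t d) (state z U P g o) =
  c`_0 * z + c`_1 * U%:R + c`_2 * P%:R + c`_3 * g%:R + c`_4 * o%:R.
Proof. by rewrite /lhs !big_ord_recl big_ord0 /= addr0 !addrA. Qed.

(** Naming the test outcome [b] in advance reduces an instruction to one inequality, with the
    required gap, and four numerical equations. *)
Lemma exec_rule (b : bool) c t dU dP dg do_ z U P g o U' P' g' o' :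
  0 <= z ->
  (let v := c`_0 * z + c`_1 * U%:R + c`_2 * P%:R + c`_3 * g%:R + c`_4 * o%:R in
   if b then t <= v else v <= t - 1) ->
  U'%:R = U%:R + (if b then dU else 0) -> P'%:R = P%:R + (if b then dP else 0) ->
  g'%:R = g%:R + (if b then dg else 0) -> o'%:R = o%:R + (if b then do_ else 0) ->
  exec [:: rule c t [:: 0; dU; dP; dg; do_]] (state z U P g o) (state z U' P' g' o').
Proof.
move=> z0; rewrite -(lhs_rule c t [:: 0; dU; dP; dg; do_]) /= => hb hU hP hg ho.
have E : step (rule c t [:: 0; dU; dP; dg; do_]) (state z U P g o) = state z U' P' g' o'.
  apply: funext => r; rewrite /step /=.
  have -> : (t <= lhs (rule c t [:: 0; dU; dP; dg; do_]) (state z U P g o)) = b.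
    by case: (b) hb => // hb; rewrite leNgt (le_lt_trans hb)//; lra.
  case: r => [[|[|[|[|[|//]]]]] ?]; rewrite /state /=; last 4 first.
  - by rewrite hU.
  - by rewrite hP.
  - by rewrite hg.
  - by rewrite ho.
  by case: (b); rewrite addr0.
have P0 U1 P1 g1 o1 r : 0 <= state z U1 P1 g1 o1 r.
  by case: r => [[|[|[|[|[|//]]]]] ?]; rewrite /state /= ?ler0n.
split; rewrite ?E//.
by case: (b) hb => ?; [left|right].
Qed.

Lemma natr_leB x y : (x < y)%N -> x%:R <= y%:R - 1 :> R.
Proof. by rewrite lerBrDr natr1 ler_nat. Qed.

Lemma leading_bit n v : (v < 2 ^ n.+1)%N ->
  exists v' (b : bool), v = (b * 2 ^ n + v')%N /\ (v' < 2 ^ n)%N.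
Proof.
rewrite expnS => hv; case: (ltnP v (2 ^ n)) => h; first by exists v, false.
by exists (v - 2 ^ n)%N, true; lia.
Qed.

(** Most significant bit first, the [n] bits above the low [t] bits of [U] are moved to [P]. *)
Fixpoint decode_point (t n : nat) : seq (instr R 5) :=
  if n is n'.+1 then
    rule [:: 0; 1] (2 ^ (t + n'))%:R
      [:: 0; - (2 ^ (t + n'))%:R; (2 ^ n')%:R; 0; 0] :: decode_point t n'
  else [::].

Lemma exec_decode_point t n v w z P g o : 0 <= z -> (v < 2 ^ n)%N -> (w < 2 ^ t)%N ->
  exec (decode_point t n) (state z (v * 2 ^ t + w) P g o) (state z w (P + v) g o).
Proof.
move=> z0; elim: n v P => [|n IH] v P hv hw.
  by case: v hv => //; rewrite mul0n add0n addn0.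
have [v' [b [vE hv']]] := leading_bit hv.
apply: (@exec_cat _ _ [:: _] _ _ (state z (v' * 2 ^ t + w) (P + b * 2 ^ n) g o)).
  apply: (exec_rule (b := b)) => //=.
  - rewrite !mul0r !addr0 add0r mul1r vE expnD.
    have : (v' * 2 ^ t + w < 2 ^ n * 2 ^ t)%N by nia.
    case: (b) => h; first by rewrite ler_nat; nia.
    by rewrite natr_leB//; nia.
  - rewrite vE expnD mulnDl !natrD !natrM; case: (b) => /=; ring.
  - by rewrite natrD natrM; case: (b); rewrite ?mul1r ?mul0r.
  - by case: (b); rewrite addr0.
  - by case: (b); rewrite addr0.
by rewrite vE addnA; apply: IH.
Qed.

(** An update only adds a constant, so [P] cannot be zeroed at once; its bits are stripped from the
    top. *)
Fixpoint clear_point (n : nat) : seq (instr R 5) :=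
  if n is n'.+1 then
    rule [:: 0; 0; 1] (2 ^ n')%:R [:: 0; 0; - (2 ^ n')%:R; 0; 0] :: clear_point n'
  else [::].

Lemma exec_clear_point n v z U g o : 0 <= z -> (v < 2 ^ n)%N ->
  exec (clear_point n) (state z U v g o) (state z U 0 g o).
Proof.
move=> z0; elim: n v => [|n IH] v hv; first by case: v hv.
have [v' [b [vE hv']]] := leading_bit hv.
apply: (@exec_cat _ _ [:: _] _ _ (state z U v' g o)); last exact: IH.
apply: (exec_rule (b := b)) => //=.
- rewrite !mul0r !addr0 add0r mul1r vE.
  case: (b); first by rewrite ler_nat; lia.
  by rewrite natr_leB//; lia.
- by case: (b); rewrite addr0.
- by rewrite vE natrD natrM; case: (b) => /=; ring.
- by case: (b); rewrite addr0.
- by case: (b); rewrite addr0.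
Qed.

(* As U < 2^(t+n'+1) and the flag is 0 or 1, the first rule fires exactly when
   the leading bit of U and the flag are both 1. *)
Fixpoint decode_label (t n : nat) : seq (instr R 5) :=
  if n is n'.+1 then
    rule [:: 0; 1; 0; (2 ^ (t + n').+1)%:R] (3 * 2 ^ (t + n'))%:R
      [:: 0; 0; 0; 0; (2 ^ n')%:R] ::
    rule [:: 0; 1] (2 ^ (t + n'))%:R [:: 0; - (2 ^ (t + n'))%:R; 0; 0; 0] ::
    decode_label t n'
  else [::].

Lemma exec_decode_label t n v w z P (g : bool) o :
  0 <= z -> (v < 2 ^ n)%N -> (w < 2 ^ t)%N ->
  exec (decode_label t n) (state z (v * 2 ^ t + w) P g o) (state z w P g (o + g * v)).
Proof.
move=> z0; elim: n v o => [|n IH] v o hv hw.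
  by case: v hv => //; rewrite mul0n add0n muln0 addn0.
have [v' [b [vE hv']]] := leading_bit hv.
have hv2 : (v' * 2 ^ t + w < 2 ^ n * 2 ^ t)%N by nia.
apply: (@exec_cat _ _ [:: _] _ _ (state z (v * 2 ^ t + w) P g (o + (g && b) * 2 ^ n))).
  apply: (exec_rule (b := g && b)) => //=.
  - rewrite !mul0r !addr0 add0r mul1r vE -natrM -natrD expnS expnD.
    by case: (g); case: (b); rewrite /= ?ler_nat ?natr_leB//; nia.
  - by case: andP; rewrite addr0.
  - by case: andP; rewrite addr0.
  - by case: andP; rewrite addr0.
  - by rewrite natrD natrM; case: andP; rewrite ?mul1r ?mul0r.
apply: (@exec_cat _ _ [:: _] _ _ (state z (v' * 2 ^ t + w) P g (o + (g && b) * 2 ^ n))).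
  apply: (exec_rule (b := b)) => //=.
  - rewrite !mul0r !addr0 add0r mul1r vE expnD.
    case: (b); first by rewrite ler_nat; nia.
    by rewrite natr_leB//; nia.
  - rewrite vE expnD mulnDl !natrD !natrM; case: (b) => /=; ring.
  - by case: (b); rewrite addr0.
  - by case: (b); rewrite addr0.
  - by case: (b); rewrite addr0.
suff -> : (o + g * v = o + (g && b) * 2 ^ n + g * v')%N by apply: IH.
by rewrite vE; case: (g); case: (b); lia.
Qed.

Definition hit (z : R) (p : nat) : bool := 0 <= z - p%:R <= 1.

(** The flag is raised if [z >= P] and lowered again if [z >= P + 2], so it stays up only for a hit;
    afterwards flag and [P] are cleared for the next entry. *)
Definition decode_entry (t b : nat) : seq (instr R 5) :=
  decode_point (t + b) b ++
  [:: rule [:: 1; 0; -1] 0 [:: 0; 0; 0; 1; 0];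
      rule [:: 1; 0; -1] 2 [:: 0; 0; 0; -1; 0]] ++
  decode_label t b ++
  rule [:: 0; 0; 0; 1] 1 [:: 0; 0; 0; -1; 0] :: clear_point b.

(** Exactly the positions of [z] at which the tests with thresholds 0 and 2 both meet the gap
    condition. *)
Definition separated (z : R) (p : nat) : Prop :=
  [\/ 0 <= z - p%:R <= 1, z - p%:R <= -1 | 2 <= z - p%:R].

Lemma exec_decode_entry t b p y w z o :
  0 <= z -> separated z p -> (p < 2 ^ b)%N -> (y < 2 ^ b)%N -> (w < 2 ^ t)%N ->
  exec (decode_entry t b) (state z ((p * 2 ^ b + y) * 2 ^ t + w) 0 0 o)
    (state z w 0 0 (o + hit z p * y)).
Proof.
move=> z0 sep hp hy hw.
apply: (exec_cat (s2 := state z (y * 2 ^ t + w) p 0 o)).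
  have -> : ((p * 2 ^ b + y) * 2 ^ t + w = p * 2 ^ (t + b) + (y * 2 ^ t + w))%N.
    by rewrite expnD; lia.
  by rewrite -[p in X in exec _ _ X]add0n; apply: exec_decode_point; rewrite ?expnD; nia.
apply: (exec_cat (s2 := state z (y * 2 ^ t + w) p (hit z p) o)).
  apply: (@exec_cat _ _ [:: _] [:: _] _ (state z (y * 2 ^ t + w) p (0 <= z - p%:R)%R o)).
    apply: (exec_rule (b := 0 <= z - p%:R)); rewrite //= ?if_same ?addr0 ?add0r//.
      rewrite mul1r !mul0r !addr0 mulN1r.
      by case: sep => [/andP[->]//|h|h]; case: ifP => //; lra.
    by case: (_ <= _).
  apply: (exec_rule (b := 2 <= z - p%:R)); rewrite //= ?if_same ?addr0 ?add0r//.
    rewrite mul1r !mul0r !addr0 mulN1r.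
    by case: sep => [/andP[]|h|h]; case: ifP => //; lra.
  rewrite /hit; case: sep => [/andP[h1 h2]|h|h].
  - by rewrite h1 h2 ifN ?addr0// -ltNge; lra.
  - have -> : (0 <= z - p%:R) = false by apply/negbTE; rewrite -ltNge; lra.
    by rewrite ifN ?addr0// -ltNge; lra.
  - have -> : (0 <= z - p%:R) by lra.
    have -> : (z - p%:R <= 1) = false by apply/negbTE; rewrite -ltNge; lra.
    by rewrite h subrr.
apply: (exec_cat (s2 := state z w p (hit z p) (o + hit z p * y))).
  exact: exec_decode_label.
apply: (@exec_cat _ _ [:: _] _ _ (state z w p 0 (o + hit z p * y))).
  apply: (exec_rule (b := hit z p)); rewrite //= ?if_same ?addr0//.
    by rewrite !mul0r !addr0 !add0r mul1r; case: (hit z p) => //=; lra.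
  by case: (hit z p); rewrite ?subrr ?addr0.
exact: exec_clear_point.
Qed.

(** Concatenation of words of [2 * b] bits, the first entry in the leading bits, where extraction
    starts. *)
Fixpoint code (b : nat) (es : seq (nat * nat)) : nat :=
  if es is e :: es' then
    ((e.1 * 2 ^ b + e.2) * 2 ^ (2 * b * size es') + code b es')%N
  else 0.

Definition small (b : nat) (e : nat * nat) := (e.1 < 2 ^ b)%N && (e.2 < 2 ^ b)%N.

Lemma code_lt b es : all (small b) es -> (code b es < 2 ^ (2 * b * size es))%N.
Proof.
elim: es => [|e es IH] /=; first by rewrite expn_gt0.
move=> /andP[/andP[h1 h2] /IH {}IH].
have -> : (2 * b * (size es).+1 = b + b + 2 * b * size es)%N by lia.
rewrite !expnD; set q := (2 ^ (2 * b * _))%N in IH *; set w := (2 ^ b)%N in h1 h2 *.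
have : (e.1 * w + e.2 < w * w)%N by nia.
nia.
Qed.

Fixpoint decode (b k : nat) : seq (instr R 5) :=
  if k is k'.+1 then decode_entry (2 * b * k') b ++ decode b k' else [::].

Lemma exec_decode b es z o : 0 <= z -> all (small b) es ->
  (forall e, e \in es -> separated z e.1) ->
  exec (decode b (size es)) (state z (code b es) 0 0 o)
    (state z 0 0 0 (o + \sum_(e <- es) hit z e.1 * e.2)).
Proof.
move=> z0; elim: es o => [|e es IH] o /=; first by rewrite big_nil addn0.
move=> /andP[/andP[h1 h2] hs] sep; rewrite big_cons addnA.
apply: exec_cat; last by apply: IH => // e' he'; apply: sep; rewrite in_cons he' orbT.
apply: exec_decode_entry => //; last exact: code_lt.
by apply: sep; rewrite mem_head.
Qed.

Lemma size_decode b k : size (decode b k) = (k * (4 * b + 3))%N.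
Proof.
have h1 t n : size (decode_point t n) = n by elim: n => //= n ->.
have h2 t n : size (decode_label t n) = (2 * n)%N by elim: n => //= n ->; lia.
have h3 n : size (clear_point n) = n by elim: n => //= n ->.
(* Per entry: [b] rules for the point, [2 * b] for the label, [b] for clearing [P] and 3 for the
   flag. *)
by elim: k => //= k IH; rewrite /decode_entry !size_cat /= h1 h2 h3 IH; lia.
Qed.

(** The updates telescope: if exactly the first [a] thresholds are passed, [U] moves from [c 0] to
    [c a]. *)
Definition select_rule (tau : nat -> R) (c : nat -> nat) (j : nat) : instr R 5 :=
  rule [:: 1] (tau j) [:: 0; (c j.+1)%:R - (c j)%:R; 0; 0; 0].

Lemma exec_select tau c m a z o : 0 <= z ->
  (forall j, (j < m)%N -> if (j < a)%N then tau j <= z else z <= tau j - 1) ->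
  exec [seq select_rule tau c j | j <- iota 0 m] (state z (c 0%N) 0 0 o)
    (state z (c (minn m a)) 0 0 o).
Proof.
move=> z0; elim: m => [|m IH] h; first by rewrite min0n.
have -> : iota 0 m.+1 = iota 0 m ++ [:: m] by rewrite -addn1 iotaD.
rewrite map_cat; apply: exec_cat.
  by apply: IH => j jm; apply: h; lia.
apply: (exec_rule (b := (m < a)%N)); rewrite //= ?if_same ?addr0//.
  by rewrite mul1r !mul0r !addr0; apply: h; lia.
case: ltnP => h'.
  by rewrite (_ : minn _ a = m.+1) 1?addrC ?subrK//; lia.
by rewrite addr0; congr (c _)%:R; lia.
Qed.

End Programs.

(** * Memorization on the line *)

Section Line.
Variables (R : realType) (zeta : nat -> R) (psi : nat -> nat) (G k m b : nat).
Hypotheses (G0 : (0 < G)%N) (k0 : (0 < k)%N).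
Hypothesis zeta_gap : forall i j, (i < j)%N -> zeta i + 2 <= zeta j.
Hypothesis zeta_ge2 : 2 <= zeta 0%N.
Hypothesis zeta_lt : forall n, (n < G * (m * k))%N -> zeta n < (2 ^ b)%:R.
Hypothesis psi_lt : forall n, (n < G * (m * k))%N -> (psi n < 2 ^ b)%N.

Definition entry (i : nat) : nat * nat := (Num.truncn (zeta i), psi i).

Definition chunk (g j : nat) : seq (nat * nat) :=
  [seq entry i | i <- iota (g * (m * k) + j * k)%N k].

(** The shift by one arises because interval [j] is selected once [j.+1] thresholds are passed; the
    code 0 is for inputs before the block. *)
Definition block_code (g j : nat) : nat := if j is j'.+1 then code b (chunk g j') else 0.

Definition line_prog : seq ('I_G -> instr R 5) :=
  [seq (fun g : 'I_G => select_rule (fun j => zeta (g * (m * k) + j * k)%N) (block_code g) j)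
     | j <- iota 0 m] ++
  [seq (fun=> i) | i <- decode R b k].

Lemma zeta_ge n : 2 <= zeta n.
Proof.
case: n => [|n]; first exact: zeta_ge2.
by rewrite (le_trans _ (zeta_gap (ltn0Sn n)))// lerDr (le_trans _ zeta_ge2).
Qed.

(** Truncation lowers a sample by less than 1, so the gap of 2 between samples survives as at least
    2 above smaller entries and more than 1 below larger ones. *)
Lemma entry_cmp n i :
  if i == n then 0 <= zeta n - (entry i).1%:R <= 1
  else (zeta n - (entry i).1%:R <= -1) || (2 <= zeta n - (entry i).1%:R).
Proof.
have := truncn_itv (le_trans (ler0n _ 2) (zeta_ge i)) => /=.
rewrite -natr1 => /andP[h1 h2].
by case: ltngtP => [/zeta_gap h|/zeta_gap h|<-]; lra.
Qed.

Lemma entry_separated n i : separated (zeta n) (entry i).1.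
Proof.
have := entry_cmp n i; case: ifP => _; first by constructor 1.
by case/orP => ?; [constructor 2|constructor 3].
Qed.

Lemma hit_entry n i : hit (zeta n) (entry i).1 = (i == n).
Proof.
have := entry_cmp n i; rewrite /hit; case: ifP => // _ h.
by apply/negbTE; rewrite negb_and -!ltNge; case/orP: h => h; lra.
Qed.

(** Only the block of sample [n] decodes its entry: later blocks decode zeros, and earlier ones
    decode their last interval without a hit. *)
Lemma exec_block (g : 'I_G) n : (n < G * (m * k))%N ->
  exec [seq i g | i <- line_prog] (state (zeta n) 0 0 0 0)
    (state (zeta n) 0 0 0 ((g == n %/ (m * k) :> nat) * psi n)%N).
Proof.
move=> hn; rewrite /line_prog map_cat -!map_comp.
rewrite (eq_map (g := id)) // map_id.
have z0 := le_trans (ler0n _ 2) (zeta_ge n).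
pose tau j := zeta (g * (m * k) + j * k)%N.
have sel a := @exec_select _ tau (block_code g) m a (zeta n) 0 z0.
move: sel; rewrite {}/tau; move oE : (g * (m * k))%N => o sel.
(* The number of thresholds passed, before capping at [m]. The case [n < o] is separate because
   truncated subtraction would yield 1 there. *)
pose a := if (n < o)%N then 0%N else ((n - o) %/ k).+1.
apply: (exec_cat (s2 := state (zeta n) (block_code g (minn m a)) 0 0 0)).
  rewrite (eq_map (g := select_rule (fun j => zeta (o + j * k)%N) (block_code g)));
    last first.
    by move=> j; rewrite /= oE.
  apply: sel => j jm.
  have -> : (j < a)%N = (o + j * k <= n)%N.
    rewrite /a; case: (ltnP n o) => no; first by lia.
    by rewrite ltnS leq_divRL// leq_subRL.
  case: ltngtP => [/zeta_gap|/zeta_gap|->]; lra.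
have m0 : (0 < m)%N by move: hn; case: (m) => //; rewrite mul0n muln0.
have [es [-> szes [smes [sepes sumes]]]] : exists es,
    [/\ block_code g (minn m a) = code b es, size es = k &
     all (small b) es /\ (forall e, e \in es -> separated (zeta n) e.1) /\
     (\sum_(e <- es) hit (zeta n) e.1 * e.2 = (g == n %/ (m * k) :> nat) * psi n)%N].
  case E: (minn m a) => [|j].
    (* The code 0 reads as [k] entries [(0, 0)]: the gap condition holds as [zeta n >= 2], and the
       labels add nothing. *)
    exists (nseq k (0, 0)%N); split; [|exact: size_nseq|split; [|split]].
    - by elim: (k) => //= k' <-.
    - by apply/allP => e /nseqP[-> _]; rewrite /small /= expn_gt0.
    - by move=> e /nseqP[-> _]; constructor 3; rewrite subr0 zeta_ge.
    - rewrite big1_seq => [|e /andP[_ /nseqP[-> _]]]; last exact: muln0.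
      suff /negbTE-> : (g != n %/ (m * k) :> nat)%N by [].
      have no : (n < o)%N by move: E; rewrite /a; case: (ltnP n o) => // _; lia.
      by rewrite neq_ltn ltn_divLR ?muln_gt0 ?m0// oE no orbT.
  have [on aE] : (o <= n)%N /\ a = ((n - o) %/ k).+1.
    by move: E; rewrite /a; case: (ltnP n o) => //; rewrite minn0.
  have jm : (j < m)%N by rewrite -E geq_minl.
  have gG : (o + m * k <= G * (m * k))%N by rewrite -oE -mulSnr leq_mul2r ltn_ord orbT.
  have jk : (j.+1 * k <= m * k)%N by rewrite leq_mul2r jm orbT.
  exists (chunk g j); split=> //; first by rewrite size_map size_iota.
  split; [|split].
  - apply/allP => e /mapP[i]; rewrite mem_iota => /andP[_ hi] ->.
    have hi' : (i < G * (m * k))%N by lia.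
    rewrite /small /= psi_lt// andbT -(ltr_nat R) (le_lt_trans _ (zeta_lt hi'))//.
    by have /andP[] := truncn_itv (le_trans (ler0n _ 2) (zeta_ge i)).
  - by move=> e /mapP[i _ ->]; exact: entry_separated.
  - rewrite big_map oE.
    under eq_bigr => i _ do rewrite hit_entry /=.
    (* If [n] precedes the end of the block, the interval read is the one of [n]; otherwise it is
       the last one, which [n] has passed. *)
    have E2 : (g == n %/ (m * k) :> nat)%N = (n \in iota (o + j * k)%N k).
      rewrite mem_iota; have mk0 : (0 < m * k)%N by rewrite muln_gt0 m0.
      have [nlt|nge] := ltnP n (o + m * k).
        have lt : ((n - o) %/ k < m)%N by rewrite ltn_divLR//; lia.
        have jE : j = ((n - o) %/ k)%N.
          by move: E; rewrite aE (minn_idPr lt) => -[].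
        have := leq_divM (n - o) k; have := ltn_ceil (n - o) k0.
        rewrite -jE => h1 h2.
        have -> : (o + j * k <= n < o + j * k + k)%N by lia.
        rewrite -[n in LHS](subnKC on) -[X in (X + _)%N]oE divnMDl// divn_small.
          by rewrite addn0 eqxx.
        by lia.
      have jE : j = m.-1.
        have le : (m <= (n - o) %/ k)%N by rewrite leq_divRL// leq_subRL.
        by move: E; rewrite aE (minn_idPl (leqW le)) => ->.
      have -> : (o + j * k <= n < o + j * k + k)%N = false.
        by rewrite -addnA -mulSnr jE prednK//; lia.
      by apply/negbTE; rewrite neq_ltn leq_divRL// mulSnr oE nge.
    rewrite E2; case: (boolP (n \in _)) => hn'.
      rewrite (bigD1_seq n) ?iota_uniq//= eqxx big1 ?addn0// => i /negbTE->.
      exact: mul0n.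
    rewrite mul0n big1_seq// => i /andP[_ hi].
    by case: eqP hi hn' => // -> ->.
rewrite -[X in decode R b X]szes -[X in state _ 0 0 0 X]add0n -sumes.
exact: exec_decode.
Qed.

(** Each block has 5 registers and 2 test neurons. Besides two layers per instruction there are the
    loading layer, the identity layer and the output layer. *)
Lemma line_memorization : exists F : relu_net R 1,
  [/\ net_width F = (G * 7)%N,
      net_depth F = (2 * (m + k * (4 * b + 3)) + 3)%N,
      (net_params F <= G * (35 + 112 * (m + k * (4 * b + 3))))%N &
      forall n, (n < G * (m * k))%N -> net_fun F (const_mx (zeta n)) = (psi n)%:R].
Proof.
pose J : finType := ('I_G * ('I_5 + bool))%type.
have cJ : #|J| = (G * 7)%N by rewrite card_prod card_sum !card_ord card_bool.
have J0 : (0 < #|J|)%N by rewrite cJ muln_gt0 G0.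
pose V (q : J) : R := if q.2 is inl r then (r == ord_max)%:R else 0.
pose W : 'M[R]_(#|J|, 1) :=
  \matrix_(i, _) if (enum_val i : J).2 is inl r then (r == ord0)%:R else 0.
have sz : size (prog_layers line_prog) = (2 * (m + k * (4 * b + 3)))%N.
  by rewrite size_prog_layers size_cat !size_map size_iota size_decode.
exists (AddLayer J0 W 0 (net_of_layers J0 (prog_layers line_prog) V)).
split=> [|||n hn] /=.
- by rewrite net_of_layers_width maxnn cJ.
- by rewrite net_of_layers_depth sz; lia.
- have h1 := nnz_le W; have h2 := nnz_le (0 : 'cV[R]_#|J|).
  have := net_of_layers_params J0 V (@prog_layers_weights _ _ _ line_prog).
  move: (nnz _) (nnz _) (net_params _) h1 h2 => a c p.
  by rewrite sz cJ !muln1; nia.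
- have z0 := le_trans (ler0n _ 2) (zeta_ge n).
  have -> : relu (W *m const_mx (zeta n) + 0) =
      col_of (fun q : J => enc (state (zeta n) 0 0 0 0) q.2).
    apply/colP => i; rewrite !mxE big_ord1 !mxE addr0.
    case: (enum_val i) => g [[[|[|[|[|[|//]]]]] ?]|c];
      rewrite /enc /state /= ?mul1r ?mul0r ?maxxx//; exact/max_idPr.
  rewrite net_of_layers_fun (exec_prog_layers (fun g => exec_block g hn)).
  transitivity (\sum_(g < G) \sum_(a : 'I_5 + bool) V (g, a) * Num.max 0
    (enc (state (zeta n) 0 0 0 ((g == n %/ (m * k) :> nat) * psi n)%N) a)).
    by rewrite pair_bigA; apply: eq_bigr => -[].
  under eq_bigr => g _.
    rewrite big_sumType /= [X in _ + X]big1 ?addr0 => [|c _]; last exact: mul0r.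
    rewrite (bigD1 ord_max)//= [X in _ + X]big1 ?addr0 => [|r /negbTE hr]; last first.
      by rewrite /V /= hr mul0r.
    rewrite /V /= mul1r /state /= (max_idPr _) ?ler0n// natrM.
    over.
  have m0 : (0 < m)%N by move: hn; case: (m) => //; rewrite mul0n muln0.
  have lt : (n %/ (m * k) < G)%N by rewrite ltn_divLR ?muln_gt0 ?m0.
  rewrite (bigD1 (Ordinal lt))//= eqxx mul1r big1 ?addr0// => g.
  by rewrite -val_eqE /= => /negbTE->; rewrite mul0r.
Qed.

End Line.

(** * Projection to the line *)

(** The samples are sorted; past [N] an arithmetic progression above [H] continues them, so that
    blocks of equal size can be filled. *)
Lemma sorted_extension (R : realType) (N C : nat) (z : 'I_N -> R)
    (y : 'I_N -> nat) (H : R) :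
  (0 < N)%N -> (forall i, 2 <= z i <= H) -> (forall i, (y i <= C)%N) ->
  (forall i j, i != j -> 2 <= `|z i - z j|) ->
  exists (zeta : nat -> R) (psi : nat -> nat),
    [/\ forall i j, (i < j)%N -> zeta i + 2 <= zeta j, 2 <= zeta 0%N,
        forall n, zeta n <= H + 2 + 2 * n%:R, forall n, (psi n <= C)%N
      & forall i, exists2 n, (n < N)%N & zeta n = z i /\ psi n = y i].
Proof.
move=> N0 zH yC gap; pose i0 := Ordinal N0.
pose leT i j := z i <= z j.
pose s := sort leT (enum 'I_N).
have szs : size s = N by rewrite size_sort size_enum_ord.
have us : uniq s by rewrite sort_uniq enum_uniq.
have ss : sorted leT s by apply: sort_sorted => i j; exact: le_total.
pose zeta n := if (n < N)%N then z (nth i0 s n) else H + 2 + 2 * n%:R.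
have H2 : 2 <= H by have /andP[/le_trans] := zH i0; apply.
have zetaH n : zeta n <= H + 2 + 2 * n%:R.
  rewrite /zeta; case: ifP => // _; have /andP[_] := zH (nth i0 s n).
  by have := ler0n R n; lra.
(* Past [N] the default [i0] of [nth] supplies a label, still at most [C]. *)
exists zeta, (fun n => y (nth i0 s n)); split=> // [i j ij||i].
- have [jN|jN] := ltnP j N; last first.
    rewrite [leRHS]/zeta ltnNge jN /=; have [iN|iN] := ltnP i N.
      rewrite /zeta iN; have /andP[_] := zH (nth i0 s i).
      by have := ler0n R j; lra.
    rewrite /zeta ltnNge iN /=.
    have : i.+1%:R <= j%:R :> R by rewrite ler_nat.
    by rewrite -natr1; lra.
  have iN := ltn_trans ij jN.
  rewrite /zeta iN jN.
  have le : leT (nth i0 s i) (nth i0 s j).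
    apply: sorted_leq_nth => //; rewrite ?inE ?szs//; last exact: ltnW.
    - by move=> a b c; exact: le_trans.
    - by move=> a; exact: lexx.
  have ne : nth i0 s i != nth i0 s j by rewrite nth_uniq ?szs// ltn_eqF.
  by have := gap _ _ ne; rewrite ler0_norm; move: le; rewrite /leT; lra.
- by rewrite /zeta N0; have /andP[] := zH (nth i0 s 0).
- have si : i \in s by rewrite mem_sort mem_enum.
  have iN : (index i s < N)%N by have := si; rewrite -index_mem szs.
  by exists (index i s); rewrite // /zeta iN nth_index.
Qed.

(* For fixed values of the other coordinates, at most one value of u k0 gives
   an inner product smaller than e / 2. *)
Lemma card_small_products (R : realType) (d M : nat) (v : 'I_d -> R) (k0 : 'I_d) (e : R) :
  e <= `|v k0| ->
  (#|[set u : {ffun 'I_d -> 'I_M} | (`|\sum_k (u k)%:R * v k| < e / 2)%R]| * M <= M ^ d)%N.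
Proof.
move=> ve; set B := [set u | _].
(* [f] overwrites coordinate [k0]; its injectivity on pairs from [B] and ['I_M] gives the count. *)
pose f (p : {ffun 'I_d -> 'I_M} * 'I_M) := [ffun k => if k == k0 then p.2 else p.1 k].
have <- : #|[set f p | p in setX B [set: 'I_M]]| = (#|B| * M)%N.
  rewrite card_in_imset ?cardsX ?cardsT ?card_ord// => -[u a] [u' a'].
  rewrite !inE !andbT /= => hu hu' /ffunP eqf.
  have -> : a = a' by have := eqf k0; rewrite !ffunE eqxx.
  have eqk k : k != k0 -> u k = u' k.
    by move=> kk0; have := eqf k; rewrite !ffunE (negbTE kk0).
  congr pair; apply/ffunP => k; have [->|/eqk//] := eqVneq k k0.
  (* If [u] and [u'] differed at [k0], their inner products would be at least [e] apart, though both
     are below [e / 2] in absolute value. *)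
  apply/eqP; apply: contraTT (ve) => ne; rewrite -ltNge.
  have E : \sum_k (u k)%:R * v k - \sum_k (u' k)%:R * v k =
      ((u k0)%:R - (u' k0)%:R) * v k0.
    rewrite -sumrB (bigD1 k0)//= big1 ?addr0 ?mulrBl// => k' /eqk->.
    exact: subrr.
  have h1 : 1 <= `|(u k0)%:R - (u' k0)%:R : R|.
    move: ne; rewrite -val_eqE neq_ltn => /orP[] h; [rewrite distrC|];
      rewrite -natrB 1?ltnW// normr_nat -[1]/(1%:R) ler_nat subn_gt0 //.
  have h2 := ler_normB (\sum_k (u k)%:R * v k) (\sum_k (u' k)%:R * v k).
  rewrite E normrM in h2.
  have : `|v k0| <= `|(u k0)%:R - (u' k0)%:R| * `|v k0| by rewrite ler_peMl.
  by move: h2 hu hu'; lra.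
apply: leq_trans (max_card _) _.
by rewrite card_ffun !card_ord.
Qed.

Lemma l2norm_coord (R : realType) (d : nat) (v : 'cV[R]_d) k : `|v k 0| <= l2norm v.
Proof.
rewrite -sqrtr_sqr ler_wsqrtr// (bigD1 k)//= lerDl.
by apply: sumr_ge0 => i _; exact: sqr_ge0.
Qed.

Lemma exists_large_coord (R : realType) (d : nat) (v : 'cV[R]_d) (e : R) :
  (0 < d)%N -> 0 < e -> e <= l2norm v -> exists k, e / d%:R <= `|v k 0|.
Proof.
move=> d0 e0 ev; apply: contrapT => /forallNP h.
have d1 : (1 : R) <= d%:R by rewrite ler1n.
have : \sum_(k < d) v k 0 ^+ 2 < e ^+ 2.
  apply: (@lt_le_trans _ _ (\sum_(k < d) (e / d%:R) ^+ 2)).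
    apply: ltr_sum => [|k _].
      by apply/hasP; exists (Ordinal d0); rewrite ?mem_index_enum.
    rewrite -real_normK ?num_real// ltr_pXn2r ?nnegrE ?divr_ge0// ?ltW//.
    by rewrite ltNge; apply/negP/h.
  rewrite sumr_const card_ord -[leLHS]mulr_natl expr_div_n mulrCA ler_piMr ?sqr_ge0//.
  by rewrite ler_pdivrMr ?mul1r ?ler_eXnr ?exprn_gt0//; lra.
apply/negP; rewrite -leNgt -[leRHS]sqr_sqrtr; last first.
  by apply: sumr_ge0 => k _; exact: sqr_ge0.
by rewrite ler_pXn2r ?nnegrE ?sqrtr_ge0 ?(ltW e0)//.
Qed.

(** Union bound: each of the [N ^ 2] ordered pairs excludes at most a fraction [1 / M] of the
    [M ^ d] candidates, and [M = N ^ 2 + 1]. *)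
Lemma separating_direction (R : realType) (d N : nat) (x : 'I_N -> 'cV[R]_d) (delta : R) :
  (0 < d)%N -> 0 < delta -> (forall i j, i != j -> delta <= l2norm (x i - x j)) ->
  exists u : 'I_d -> nat, (forall k, (u k <= N ^ 2)%N) /\
    forall i j, i != j ->
      delta / (2 * d%:R) <= `|\sum_k (u k)%:R * x i k 0 - \sum_k (u k)%:R * x j k 0|.
Proof.
move=> d0 dl0 sep; pose M := (N ^ 2).+1.
pose B (p : 'I_N * 'I_N) := [set u : {ffun 'I_d -> 'I_M} |
  (p.1 != p.2) && (`|\sum_k (u k)%:R * (x p.1 - x p.2) k 0| < delta / d%:R / 2)].
have cB p : (#|B p| * M <= M ^ d)%N.
  have [e|ne] := eqVneq p.1 p.2.
    rewrite (_ : B p = set0) ?cards0//; apply/setP => u.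
    by rewrite !inE e eqxx.
  have [k hk] := exists_large_coord d0 dl0 (sep _ _ ne).
  apply: leq_trans _ (card_small_products (v := fun k => (x p.1 - x p.2) k 0) M hk).
  rewrite leq_mul2r; apply/orP; right.
  by apply: subset_leq_card; apply/subsetP => u; rewrite !inE => /andP[].
have [u hu] : exists u, forall p, u \notin B p.
  apply: contrapT => /forallNP bad.
  have : (M ^ d * M <= N ^ 2 * M ^ d)%N.
    have -> : (M ^ d = \sum_(u : {ffun 'I_d -> 'I_M}) 1)%N.
      by rewrite sum1_card card_ffun !card_ord.
    have le : (\sum_(u : {ffun 'I_d -> 'I_M}) 1 <= \sum_p #|B p|)%N.
      under [leqRHS]eq_bigr do rewrite -sum1_card big_mkcond.
      rewrite exchange_big; apply: leq_sum => u _.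
      have /existsNP[p /negP] := bad u; rewrite negbK => up.
      by rewrite (bigD1 p)//= up.
    apply: leq_trans (leq_mul le (leqnn M)) _.
    rewrite big_distrl /= sum1_card card_ffun !card_ord.
    apply: leq_trans (leq_sum _ (fun p _ => cB p)) _.
    by rewrite sum_nat_const card_prod !card_ord mulnn.
  by rewrite mulnC leq_mul2r leqNgt ltnS leqnn orbF -leqn0 leqNgt expn_gt0.
exists (fun k => u k : nat); split=> [k|i j ij]; first by rewrite -ltnS ltn_ord.
have := hu (i, j); rewrite inE /= ij /= -leNgt => h.
rewrite -sumrB; under eq_bigr do rewrite -mulrBr.
rewrite invfM mulrCA mulrC; apply: le_trans h _.
by under eq_bigr do rewrite !mxE.
Qed.

(** * Choice of the sizes *)

Lemma log2_lt_exp (R : realType) (q : R) (t : nat) : 0 < q -> log2 q < t%:R -> q < 2 ^+ t.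
Proof.
move=> q0; have l2 : 0 < ln (2 : R) by rewrite ln_gt0 ?ltr1n.
rewrite /log2 ltr_pdivrMr// mulr_natl -lnXn// ltr_ln ?posrE ?exprn_gt0//.
Qed.

Lemma log2c_ge1 (R : realType) (q : R) : 1 <= log2c q.
Proof. by rewrite le_max lexx. Qed.

(** The exponent is the integer part of [log2c q] plus 1; the cutoff at 1 absorbs the added 1 into
    the factor 2. *)
Lemma exists_exp_gt (R : realType) (q : R) : 1 <= q ->
  exists t : nat, [/\ (0 < t)%N, q < 2 ^+ t & t%:R <= 2 * log2c q].
Proof.
move=> q1; have l1 := log2c_ge1 q.
have /andP[h1 h2] := truncn_itv (le_trans ler01 l1).
exists (Num.truncn (log2c q)).+1; split=> //.
  apply: log2_lt_exp; first lra.
  by rewrite (le_lt_trans _ h2)// le_max lexx orbT.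
by rewrite -natr1; lra.
Qed.

Lemma log2c_le (R : realType) (p q : R) : 0 < p -> p <= q -> log2c p <= log2c q.
Proof.
move=> p0 pq; have l2 : 0 < ln (2 : R) by rewrite ln_gt0 ?ltr1n.
have q0 := lt_le_trans p0 pq.
rewrite /log2c ge_max !le_max lexx /=; apply/orP; right.
by rewrite /log2 ler_pM2r ?invr_gt0// ler_ln.
Qed.

Lemma log2c_nat_le (R : realType) (L : nat) : (0 < L)%N -> log2c (L%:R : R) <= L%:R.
Proof.
move=> L0; have l2 : 0 < ln (2 : R) by rewrite ln_gt0 ?ltr1n.
rewrite ge_max ler1n L0 /= /log2 ler_pdivrMr// mulr_natl -lnXn//.
rewrite ler_ln ?posrE ?exprn_gt0 ?ltr0n//.
by rewrite -natrX ler_nat ltnW// ltn_expl.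
Qed.

Lemma exists_nat_sqrt (R : realType) (l : R) : 1 <= l ->
  exists s : nat, [/\ (0 < s)%N, s%:R <= Num.sqrt l & Num.sqrt l <= 2 * s%:R].
Proof.
move=> l1; have s1 : 1 <= Num.sqrt l by rewrite -[leLHS]sqrtr1 ler_wsqrtr.
have /andP[h1 h2] := truncn_itv (le_trans ler01 s1).
have s0 : (0 < Num.truncn (Num.sqrt l))%N by rewrite truncn_gt0.
exists (Num.truncn (Num.sqrt l)); split=> //.
have : (1 : R) <= (Num.truncn (Num.sqrt l))%:R by rewrite ler1n.
by move: h2; rewrite -natr1; lra.
Qed.

(* Blocks of m * k samples, with k ~ L / sqrt(log L) samples per interval and
   m ~ L sqrt(log L) intervals, so that m and k * log Q are both
   O(L / sqrt(log L) * log Q). *)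
Lemma block_sizes (R : realType) (N L : nat) (q : R) :
  (0 < L)%N -> (L ^ 2 <= N)%N -> log2c (L%:R : R) <= q ->
  exists G k m : nat,
    [/\ (0 < G)%N, (0 < k)%N, (N <= G * (m * k) <= 3 * N)%N,
        G%:R <= 2 * (N%:R / L%:R ^+ 2) :> R
      & forall b : nat, b%:R <= 14 * q ->
          (m + k * (4 * b + 3))%:R <= 237 * (L%:R / Num.sqrt (log2c (L%:R : R)) * q)].
Proof.
move=> L0 LN Lq; set l := log2c _ in Lq *.
have l1 : 1 <= l := log2c_ge1 _.
have [s [s0 sl ls]] := exists_nat_sqrt l1.
set w := Num.sqrt l in sl ls *.
have w1 : 1 <= w by rewrite -[leLHS]sqrtr1 ler_wsqrtr.
have w2 : w ^+ 2 = l by rewrite sqr_sqrtr//; lra.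
have Lr : 1 <= L%:R :> R by rewrite ler1n.
have sr : 1 <= s%:R :> R by rewrite ler1n.
have sL : (s <= L)%N.
  rewrite -(ler_nat R); apply: le_trans sl _; apply: le_trans (log2c_nat_le R L0).
  by rewrite -/l -w2; nra.
(* Here [L < k * s <= 2 * L], so [m * k] lies between [L ^ 2] and [2 * L ^ 2], and taking one block
   more than [N %/ (m * k)] costs only constant factors. *)
pose k := (L %/ s).+1; pose m := (L * s)%N.
have ks : (L < k * s)%N by rewrite ltn_ceil.
have ks2 : (k * s <= L + s)%N.
  by rewrite /k mulSn addnC leq_add2r leq_divM.
have mk1 : (L ^ 2 <= m * k)%N by rewrite /m -mulnn; nia.
have mk2 : (m * k <= 2 * N)%N by rewrite /m; nia.
have mk0 : (0 < m * k)%N by apply: leq_trans mk1; rewrite expn_gt0 L0.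
have tN : (N %/ (m * k) * (m * k) <= N)%N := leq_divM _ _.
exists (N %/ (m * k)).+1, k, m; split=> //.
- by rewrite ltnW ?ltn_ceil//= mulSn; lia.
- have L2 : 0 < L%:R ^+ 2 :> R by rewrite exprn_gt0//; lra.
  rewrite mulrA ler_pdivlMr// -natrX -!natrM ler_nat mulSn.
  by have := leq_mul (leqnn (N %/ (m * k))) mk1; lia.
- move=> b bq.
  have q1 : 1 <= q := le_trans l1 Lq.
  have mr : m%:R <= L%:R / w * q.
    rewrite mulrAC ler_pdivlMr; last lra.
    rewrite /m natrM -mulrA ler_pM2l; last lra.
    by rewrite (le_trans _ Lq)// -w2 expr2 ler_pM2r//; lra.
  have kr : k%:R <= 4 * (L%:R / w).
    rewrite mulrA ler_pdivlMr; last lra.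
    have h1 : k%:R * w <= k%:R * (2 * s%:R) by rewrite ler_wpM2l ?ler0n.
    have h2 : k%:R * s%:R <= 2 * L%:R :> R by rewrite -!natrM ler_nat; lia.
    by lra.
  (* [59 = 4 * 14 + 3]; with the factors 1 for [m] and 4 for [k], the total is
     [237 = 1 + 4 * 59]. *)
  have br : (4 * b + 3)%:R <= 59 * q by rewrite natrD natrM; lra.
  have kb : (k * (4 * b + 3))%:R <= (4 * (L%:R / w)) * (59 * q).
    by rewrite natrM; apply: ler_pM; rewrite ?ler0n.
  by rewrite natrD; lra.
Qed.

(** * Reduction to the line and assembly of the network *)

Lemma affine_net (R : realType) (d : nat) (a : 'rV[R]_d) (c : R) (F : relu_net R 1) :
  exists F' : relu_net R d,
    [/\ net_width F' = maxn 1 (net_width F), net_depth F' = (net_depth F).+1,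
        (net_params F' <= d + 1 + net_params F)%N
      & forall x : 'cV_d, 0 <= \sum_k a 0 k * x k 0 + c ->
          net_fun F' x = net_fun F (const_mx (\sum_k a 0 k * x k 0 + c))].
Proof.
(* A single neuron computes the projection, so [d] enters the parameter count additively. *)
exists (AddLayer (ltn0Sn 0) a (const_mx c) F); split=> //=.
  rewrite leq_add2r; apply: leq_add; last exact: nnz_le.
  by rewrite -[leqRHS]mul1n nnz_le.
move=> x x0; congr (net_fun F _); apply/colP => i; rewrite !mxE (max_idPr _) ord1//.
Qed.

Lemma separating_projection (R : realType) (d N : nat) (x : 'I_N -> 'cV[R]_d)
    (r delta : R) :
  (0 < d)%N -> 0 < delta -> (forall i, l2norm (x i) <= r) ->
  (forall i j, i != j -> delta <= l2norm (x i - x j)) ->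
  let H := 4 * d%:R ^+ 2 * N%:R ^+ 2 * r / delta in
  exists (a : 'rV[R]_d) (c : R), let z i := \sum_k a 0 k * x i k 0 + c in
    (forall i, 2 <= z i <= 2 * H + 2) /\ (forall i j, i != j -> 2 <= `|z i - z j|).
Proof.
move=> d0 dl0 xr sep H.
have [u [uN usep]] := separating_direction d0 dl0 sep.
have dr : 0 < d%:R :> R by rewrite ltr0n.
(* Scaling by [t] turns the separation [delta / (2 * d)] into 2; the scaled products are at most [H]
   in absolute value, so the shift [H + 2] lifts them to at least 2. *)
pose t := 4 * d%:R / delta : R.
have t0 : 0 < t by rewrite divr_gt0// mulr_gt0.
exists (\row_k (t * (u k)%:R)), (H + 2).
have E i : \sum_k (\row_k (t * (u k)%:R)) 0 k * x i k 0 = t * \sum_k (u k)%:R * x i k 0.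
  by rewrite mulr_sumr; apply: eq_bigr => k _; rewrite mxE mulrA.
split=> [i|i j ij].
  rewrite E; have : `|t * \sum_k (u k)%:R * x i k 0| <= H.
    have -> : H = t * (d%:R * (N%:R ^+ 2 * r)).
      by rewrite /H /t; field; rewrite gt_eqF.
    rewrite normrM (gtr0_norm t0) ler_pM2l//.
    apply: le_trans (ler_norm_sum _ _ _) _.
    rewrite -[d in leRHS]card_ord mulr_natl -sumr_const; apply: ler_sum => k _.
    rewrite normrM normr_nat ler_pM ?ler0n// -?natrX ?ler_nat//.
    exact: le_trans (l2norm_coord _ _) (xr i).
  by rewrite ler_norml => /andP[]; lra.
rewrite !E opprD addrACA subrr addr0 -mulrBr normrM (gtr0_norm t0).
apply: le_trans (ler_wpM2l (ltW t0) (usep _ _ ij)).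
by rewrite /t le_eqVlt; apply/orP; left; apply/eqP; field; rewrite !gt_eqF.
Qed.

Theorem theorem5p1 (R : realType) :
  exists K : R, 0 < K /\
  forall (N d C : nat) (r delta : R) (x : 'I_N -> 'cV[R]_d) (y : 'I_N -> nat)
    (L : nat),
    (0 < N)%N -> (0 < d)%N -> (0 < C)%N ->
    1 <= r -> 0 < delta -> delta <= 1 ->
    (forall i, (1 <= y i <= C)%N) ->
    (forall i, l2norm (x i) <= r) ->
    (forall i j, i != j -> delta <= l2norm (x i - x j)) ->
    (1 <= L)%N -> L%:R <= Num.sqrt (N%:R : R) ->
    let Q : R := d%:R * N%:R * C%:R * r * delta^-1 in
    exists F : relu_net R d,
      [/\ (net_width F)%:R <= K * (N%:R / L%:R ^+ 2),
          (net_depth F)%:R <=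
            K * (L%:R / Num.sqrt (log2c L%:R) * log2c Q),
          (net_params F)%:R <=
            K * (N%:R / (L%:R * Num.sqrt (log2c L%:R)) * log2c Q + d%:R)
        & forall i, net_fun F (x i) = (y i)%:R].
Proof.
(* [474 = 2 * 237] comes from blocks times instructions, [148 = 1 + 35 + 112] from the parameters
   per block and instruction, lower-order terms absorbed. *)
exists (148 * 474); split; first by rewrite mulr_gt0.
move=> N d C r delta x y L N0 d0 C0 r1 dl0 dl1 yC xr sep L0 LN Q.
have Lr : 1 <= L%:R :> R by rewrite ler1n.
have Nr : 1 <= N%:R :> R by rewrite ler1n.
have dr : 1 <= d%:R :> R by rewrite ler1n.
have Cr : 1 <= C%:R :> R by rewrite ler1n.
have LN2 : (L ^ 2 <= N)%N.
  rewrite -(ler_nat R) natrX -[leRHS]sqr_sqrtr ?ler0n//.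
  by rewrite ler_pXn2r ?nnegrE ?sqrtr_ge0 ?ler0n.
have di1 : 1 <= delta^-1 by rewrite invf_ge1.
have dN1 : 1 <= d%:R * N%:R :> R by rewrite -natrM ler1n muln_gt0 d0.
have rd1 : 1 <= r * delta^-1 by rewrite mulr_ege1.
have QE : Q = d%:R * N%:R * C%:R * (r * delta^-1) by rewrite /Q mulrA.
have dNC : d%:R * N%:R <= d%:R * N%:R * C%:R :> R by rewrite ler_peMr//; lra.
have dNCQ : d%:R * N%:R * C%:R <= Q by rewrite QE ler_peMr//; lra.
have Q1 : 1 <= Q by lra.
have NQ : N%:R <= Q by rewrite (le_trans _ dNCQ)// (le_trans _ dNC)// ler_peMl//; lra.
have CQ : C%:R <= Q by rewrite (le_trans _ dNCQ)// ler_peMl//; lra.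
have LQ : L%:R <= Q.
  by rewrite (le_trans _ NQ)// ler_nat (leq_trans _ LN2)// -mulnn leq_pmulr.
have Lq : log2c (L%:R : R) <= log2c Q by apply: log2c_le => //; lra.
have [G [k [m [G0 k0 /andP[NG GN] Gr S_le]]]] := block_sizes L0 LN2 Lq.
have [t [t0 Qt tQ]] := exists_exp_gt Q1.
have := separating_projection d0 dl0 xr sep; set H := (X in let H := X in _).
move=> /= [a [c [zH zsep]]].
have yC' i : (y i <= C)%N by have /andP[] := yC i.
have [zeta [psi [gap zeta2 zetaH psiC zetaE]]] := sorted_extension N0 zH yC' zsep.
(* As [2 ^ t] is at least 2 and exceeds [Q], five of the seven factors give 32 and two give [Q ^ 2];
   and [32 * Q ^ 2] exceeds the bound [2 * H + 4 + 6 * N] on the extended samples. *)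
pose b := (7 * t)%N.
have T2 : 2 <= 2 ^+ t :> R.
  by rewrite -[leLHS]expr1 ler_weXn2l// ler1n.
(* One factor [Q] bounds [d * N], the other [d * N * r / delta]. *)
have HQ : H <= 4 * Q ^+ 2.
  have -> : H = 4 * ((d%:R * N%:R) * (d%:R * N%:R * (r * delta^-1))).
    by rewrite /H; field; rewrite gt_eqF.
  rewrite ler_pM2l// expr2 ler_pM//; [lra|nra| lra|].
  by rewrite QE ler_wpM2r//; lra.
have bE : (2 ^ b)%:R = (2 ^+ t) ^+ 7 :> R by rewrite natrX /b mulnC exprM.
have big : 32 * Q ^+ 2 <= (2 ^ b)%:R :> R.
  rewrite bE (exprD _ 5 2) ler_pM ?sqr_ge0//.
    by apply: le_trans (_ : 2 ^+ 5 <= _); rewrite ?ler_pXn2r ?nnegrE//; lra.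
  by rewrite ler_pXn2r ?nnegrE//; lra.
have QQ : Q <= Q ^+ 2 by rewrite expr2 ler_peMl//; lra.
have zeta_lt n : (n < G * (m * k))%N -> zeta n < (2 ^ b)%:R.
  move=> hn; have : n%:R <= 3 * N%:R :> R.
    by rewrite -natrM ler_nat ltnW// (leq_trans hn GN).
  by have := zetaH n; lra.
have psi_lt n : (n < G * (m * k))%N -> (psi n < 2 ^ b)%N.
  move=> _; apply: leq_ltn_trans (psiC n) _; rewrite -(ltr_nat R); lra.
have [F [Fw Fd Fp Fz]] := line_memorization G0 k0 gap zeta2 zeta_lt psi_lt.
have [F' [Fw' Fd' Fp' Fz']] := affine_net a c F.
have bq : b%:R <= 14 * log2c Q by rewrite /b natrM; lra.
have := S_le b bq; set S := (m + _)%N => Sr.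
have S0 : (0 < S)%N by apply: ltn_addl; rewrite muln_gt0 k0 addnS.
set w := Num.sqrt _ in Sr *.
exists F'; split.
- rewrite Fw' Fw (maxn_idPr _) ?muln_gt0 ?G0// natrM.
  by move: Gr (ler0n R G); clear; move: (_ / _) (G%:R) => e g; lra.
(* The depth is [2 * S + 4], counting the projection layer. *)
- have h : (net_depth F')%:R <= 6 * S%:R :> R.
    by rewrite -natrM ler_nat Fd' Fd -/S; move: S0; clear; lia.
  by move: h Sr (ler0n R S); clear; move: (_ / _ * _) (S%:R) => e f; lra.
- have h : (net_params F')%:R <= d%:R + 148 * (G%:R * S%:R) :> R.
    rewrite -!natrM -natrD ler_nat; apply: leq_trans Fp' _.
    by move: Fp G0 S0; rewrite -/S; clear; nia.
  have GS : G%:R * S%:R <= 2 * (N%:R / L%:R ^+ 2) * (237 * (L%:R / w * log2c Q)).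
    by apply: ler_pM; rewrite ?ler0n.
  have w0 : 0 < w by rewrite sqrtr_gt0 (lt_le_trans ltr01)// log2c_ge1.
  have E : 2 * (N%:R / L%:R ^+ 2) * (237 * (L%:R / w * log2c Q)) =
           474 * (N%:R / (L%:R * w) * log2c Q).
    by field; rewrite !gt_eqF//; lra.
  rewrite E in GS; move: h GS dr; clear.
  by move: (_ * S%:R) (_ / _ * _) (d%:R) (_%:R) => g e d' p; lra.
- move=> i; have [n nN [zn pn]] := zetaE i.
  have /andP[z2 _] := zH i.
  rewrite Fz'; last lra.
  by rewrite -zn Fz ?pn// (leq_trans nN).
Qed.
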